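(* Let $p \ge 2$ and $n \ge 1$ be integers. Let $\mathcal{C}_\bullet, \widetilde{\mathcal{C}} \in \mathbb{R}^{\otimes^p n}_{\mathrm{sym}}$, let $W \in \mathbb{R}^{n\times n}$ be nonsingular, let $s \in \mathbb{R}^n$ be nonzero, and set $v = W^{-T}W^{-1}s$. Then the following four descriptions all determine one and the same tensor $\mathcal{C}_+ \in \mathbb{R}^{\otimes^p n}_{\mathrm{sym}}$, and it is unique: (a) $\mathcal{C}_+$ is the unique minimizer of $\|(\mathcal{C}-\mathcal{C}_\bullet)[W]^p\|_F$ over all $\mathcal{C} \in \mathbb{R}^{\otimes^p n}_{\mathrm{sym}}$ subject to $\mathcal{C}[s] = \widetilde{\mathcal{C}}[s]$; (b) $\mathcal{C}_+ = \mathcal{C}_\bullet + \sum_{j=1}^p (-1)^{j+1}\binom{p}{j} (v^T s)^{-j}\, P_{\mathrm{sym}}\big( (\otimes^j v) \otimes (\widetilde{\mathcal{C}}-\mathcal{C}_\bullet)[s]^j \big)$; (c) $\mathcal{C}_+ = \mathcal{C}_\bullet + P_{\mathrm{sym}}(\mathcal{A}\otimes v)$, where $\mathcal{A}$ is the unique tensor in $\mathbb{R}^{\otimes^{p-1} n}_{\mathrm{sym}}$ satisfying $P_{\mathrm{sym}}(\mathcal{A}\otimes v)[s] = (\widetilde{\mathcal{C}}-\mathcal{C}_\bullet)[s]$; (d) $(\mathcal{C}_+ - \widetilde{\mathcal{C}})[W]^p = (\mathcal{C}_\bullet - \widetilde{\mathcal{C}})[W]^p\left[ I - \frac{W^{-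1}ss^TW^{-T}}{s^TW^{-T}W^{-1}s}\right]^p$.
   Context: A $p$-tensor $\mathcal{T} \in \mathbb{R}^{\otimes^p n}$ is a multilinear map $(\mathbb{R}^n)^p \to \mathbb{R}$. For $q \le p$ vectors, $\mathcal{T}[s_1,\dots,s_q]$ is the $(p-q)$-tensor obtained by fixing the first $q$ arguments; $\mathcal{T}[s]^q$ means $\mathcal{T}[s,\dots,s]$ ($q$ times), and $\mathcal{T}[s]$ means $\mathcal{T}[s]^1$. For matrices, $(\mathcal{T}[M_1,\dots,M_p])[s_1,\dots,s_p] = \mathcal{T}[M_1s_1,\dots,M_ps_p]$, and $\mathcal{T}[M]^p = \mathcal{T}[M,\dots,M]$. The outer product is $(\mathcal{T}_1\otimes\mathcal{T}_2)[s_1,\dots,s_{p_1+p_2}] = \mathcal{T}_1[s_1,\dots,s_{p_1}]\,\mathcal{T}_2[s_{p_1+1},\dots,s_{p_1+p_2}]$ (a $0$-tensor is a scalar), vectors are regarded as 1-tensors via $v[s]=v^Ts$, and $\otimes^j v = v\otimes\cdots\otimes v$ ($j$ factors). For $\sigma$ in the symmetric group $S_p$, $\sigma(\mathcal{T})[s_1,\dots,s_p]=\mathcal{T}[s_{\sigma(1)},\dots,s_{\sigma(p)}]$; $\mathcal{T}$ is symmetric if $\sigma(\mathcal{T})=\mathcal{T}$ for all $\sigma$, $\mathbb{R}^{\otimes^p n}_{\mathrm{sym}}$ is the space of symmetric $p$-tensors, and $P_{\mathrm{sym}}(\mathcal{T}) = \frac{1}{p!}\sum_{\sigma\in S_p}\sigma(\mathcal{T})$.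 $\|\cdot\|_F$ is the Frobenius norm of the array of entries $\mathcal{T}[e_{i_1},\dots,e_{i_p}]$. *)

(* Defs.v *)
From mathcomp Require Import all_boot all_order all_algebra.
From mathcomp Require Import fingroup perm.
Set Implicit Arguments. Unset Strict Implicit. Unset Printing Implicit Defensive.
Import Order.TTheory GRing.Theory Num.Theory.
Local Open Scope ring_scope.

(* A p-tensor on R^n, stored by its array of entries
   T[e_{i_1},...,e_{i_p}], indexed by i : {ffun 'I_p -> 'I_n}. *)
Notation tensor R n p := {ffun {ffun 'I_p%N -> 'I_n%N} -> R}.

Section Tensors.
Variable R : fieldType.
Variable n : nat.

Definition tapp p (T : tensor R n p) (u : nat -> 'cV[R]_n) : R :=
  \sum_(i : {ffun 'I_p -> 'I_n}) T i * \prod_(k < p) u k (i k) 0.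

Definition basisv (l : 'I_n) : 'cV[R]_n := \col_m ((m == l)%:R).

Definition basis_seq p (i : {ffun 'I_p -> 'I_n}) : nat -> 'cV[R]_n :=
  fun k => match (insub k : option 'I_p) with Some j => basisv (i j) | None => 0 end.

(* the p-tensor whose multilinear map is F (F is evaluated on basis vectors) *)
Definition tensor_of p (F : (nat -> 'cV[R]_n) -> R) : tensor R n p :=
  [ffun i => F (basis_seq i)].

Definition tcontrN p (T : tensor R n p) (s : 'cV[R]_n) (q : nat) : tensor R n (p - q) :=
  tensor_of (p - q) (fun u => tapp T (fun k => if (k < q)%N then s else u (k - q)%N)).

Definition tcontr p (T : tensor R n p) (s : 'cV[R]_n) : tensor R n (p - 1) :=
  tcontrN T s 1.

Definition touter p1 p2 (A : tensor R n p1) (B : tensor R n p2) : tensor R n (p1 + p2) :=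
  tensor_of (p1 + p2) (fun u => tapp A u * tapp B (fun k => u (k + p1)%N)).

(* reading a tensor of order p as a tensor of order m (identity when m = p;
   only used to identify orders such as (p - 1) + 1 and p) *)
Definition tresize p m (T : tensor R n p) : tensor R n m := tensor_of m (tapp T).

Definition vtensor (v : 'cV[R]_n) : tensor R n 1 :=
  tensor_of 1 (fun u => (v^T *m u 0%N) 0 0).

Definition tpowv (j : nat) (v : 'cV[R]_n) : tensor R n j :=
  tensor_of j (fun u => \prod_(k < j) (v^T *m u k) 0 0).

Definition tperm p (sg : 'S_p) (T : tensor R n p) : tensor R n p :=
  tensor_of p (fun u => tapp T (fun k =>
    match (insub k : option 'I_p) with Some j => u (val (sg j)) | None => 0 end)).

Definition tsym p (T : tensor R n p) : Prop := forall sg : 'S_p, tperm sg T = T.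

Definition Psym p (T : tensor R n p) : tensor R n p :=
  [ffun i => (p`!%:R)^-1 * \sum_(sg : 'S_p) tperm sg T i].

Definition tscale p (c : R) (T : tensor R n p) : tensor R n p := [ffun i => c * T i].

Definition tmat p (T : tensor R n p) (M : 'M[R]_n) : tensor R n p :=
  tensor_of p (fun u => tapp T (fun k => M *m u k)).

End Tensors.

Definition fnorm (R : rcfType) n p (T : tensor R n p) : R :=
  Num.sqrt (\sum_i T i ^+ 2).

(* Main.v *)
(** A symmetric tensor is determined by its form T(x) = T[x,...,x] (polarization),
    so identities between symmetric tensors are checked on forms. With
    D = Ct - Cb and the projector Q x = x - (v.x / v.s) s, which kills s, put
    Cp = Ct - D[Q]^p. Since W M = Q W, this is (d). The binomial expansion of the
    form D(x - (v.x / v.s) s) gives (b), and pulling one factor v.x out of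
    D(x) - D(Q x) gives (c). For (a), an admissible C differs from Cp by a
    symmetric H with H[s] = 0, hence H = H[Q]^p and H[W]^p = (H[W]^p)[M]^p; as M
    is symmetric, (D - D[Q]^p)[W]^p = D[W]^p - (D[W]^p)[M]^p is orthogonal to
    H[W]^p, and Pythagoras concludes. *)
From mathcomp Require Import fingroup perm.
Require Import Defs.
From mathcomp Require Import all_boot all_order all_algebra.
From mathcomp Require Import ring.
Import Order.TTheory GRing.Theory Num.Theory.
Local Open Scope ring_scope.

(** * Multilinear functions and their arrays of entries *)

Section Multilinear.
Set Implicit Arguments. Unset Strict Implicit. Unset Printing Implicit Defensive.
Variables (R : fieldType) (n : nat).
Implicit Types (u w : nat -> 'cV[R]_n) (x y : 'cV[R]_n).

Definition upd u k x : nat -> 'cV[R]_n := fun j => if j == k then x else u j.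

Definition multilinear p (F : (nat -> 'cV[R]_n) -> R) : Prop :=
  (forall u w, (forall k, (k < p)%N -> u k = w k) -> F u = F w) /\
  (forall u k, (k < p)%N -> forall a x y,
     F (upd u k (a *: x + y)) = a * F (upd u k x) + F (upd u k y)).

Lemma multilinear_slot_sum p F u k (I : finType) (c : I -> R) (e : I -> 'cV_n) :
  multilinear p F -> (k < p)%N ->
  F (upd u k (\sum_l c l *: e l)) = \sum_l c l * F (upd u k (e l)).
Proof.
move=> [_ lF] kp; have F0 : F (upd u k 0) = 0.
  have := lF u k kp (-1) 0 0; rewrite scaler0 addr0 => ->.
  by rewrite mulN1r addNr.
elim: (index_enum I) => [|l r IH]; first by rewrite !big_nil.
by rewrite !big_cons lF // IH.
Qed.

Lemma col_sum_basisv x : x = \sum_l x l 0 *: basisv R l.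
Proof.
apply/colP=> m; rewrite summxE (bigD1 m) //= big1 ?addr0 => [|l lm].
  by rewrite !mxE eqxx mulr1.
by rewrite !mxE eq_sym (negPf lm) mulr0.
Qed.

Lemma basis_seqE p (i : {ffun 'I_p -> 'I_n}) (k : 'I_p) :
  basis_seq R i k = basisv R (i k).
Proof. by rewrite /basis_seq valK. Qed.

Definition fcons p (l : 'I_n) (i : {ffun 'I_p -> 'I_n}) : {ffun 'I_p.+1 -> 'I_n} :=
  [ffun k => if unlift ord0 k is Some j then i j else l].

Lemma fcons_bij p : bijective (fun li => @fcons p li.1 li.2).
Proof.
exists (fun f : {ffun 'I_p.+1 -> 'I_n} => (f ord0, [ffun j => f (lift ord0 j)])).
  move=> [l i] /=; rewrite ffunE unlift_none; congr (_, _).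
  by apply/ffunP=> j; rewrite !ffunE liftK.
move=> f /=; apply/ffunP=> k; rewrite !ffunE.
by case: unliftP => [j|] -> //; rewrite ffunE.
Qed.

(** Induction on the order: the first argument is expanded in the basis, and with a basis vector
    fixed there, what remains is multilinear of order one less. *)
Lemma multilinear_expand p F : multilinear p F -> forall u,
  F u = \sum_(i : {ffun 'I_p -> 'I_n}) F (basis_seq R i) * \prod_(k < p) u k (i k) 0.
Proof.
elim: p F => [|p IH] F [extF lF] u.
  rewrite (big_pred1 (ffun0 (card_ord 0))) => [|i]; last first.
    by apply/esym/eqP/ffunP; case.
  by rewrite big_ord0 mulr1; apply: extF.
pose cns l w : nat -> 'cV[R]_n := fun k => if k is k'.+1 then w k' else basisv R l.
have mlG l : multilinear p (fun w => F (cns l w)).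
  split=> [w w' ww'|w k kp a x y]; first by apply: extF => -[|k] //= /ww'.
  have updE z : F (cns l (upd w k z)) = F (upd (cns l w) k.+1 z).
    by apply: extF => -[|j].
  by rewrite !updE lF.
have -> : F u = F (upd u 0 (u 0%N)) by apply: extF => -[].
rewrite [in LHS](col_sum_basisv (u 0%N)) (multilinear_slot_sum (p := p.+1)) //.
(* An index of order [p.+1] splits into its first coordinate and an index of order [p]. *)
rewrite (reindex (fun li => @fcons p li.1 li.2)) /=; last exact/onW_bij/fcons_bij.
rewrite -(pair_bigA _ (fun l i => F (basis_seq R (fcons l i)) *
   \prod_(k < p.+1) u k (fcons l i k) 0)) /=.
apply: eq_bigr => l _.
have -> : F (upd u 0 (basisv R l)) = F (cns l (fun k => u k.+1)).
  by apply: extF => -[].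
rewrite (IH _ (mlG l)) mulr_sumr; apply: eq_bigr => i _.
rewrite big_ord_recl mulrCA; congr (_ * _); last congr (_ * _).
- apply: extF => -[|k] kp.
    by rewrite (basis_seqE _ ord0) ffunE unlift_none.
  rewrite (basis_seqE _ (Ordinal kp)) /= (basis_seqE _ (Ordinal (kp : (k < p)%N))).
  rewrite ffunE; case: unliftP => [j [ej]|//]; congr (basisv R (i _)).
  by apply: val_inj.
- by rewrite ffunE unlift_none.
by apply: eq_bigr => k _; rewrite ffunE liftK.
Qed.

(** Every operation defined through [tensor_of] is evaluated by this, once its formula is seen to be
    multilinear. *)
Lemma tapp_tensor_of p F u : multilinear p F -> tapp (tensor_of p F) u = F u.
Proof.
move=> mlF; rewrite (multilinear_expand mlF); apply: eq_bigr => i _.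
by rewrite ffunE.
Qed.

Lemma eq_tapp p (T : tensor R n p) u w :
  (forall k, (k < p)%N -> u k = w k) -> tapp T u = tapp T w.
Proof.
move=> uw; apply: eq_bigr => i _; congr (_ * _); apply: eq_bigr => k _.
by rewrite uw.
Qed.

Lemma multilinear_tapp p (T : tensor R n p) : multilinear p (tapp T).
Proof.
split=> [u w|u k kp a x y]; first exact: eq_tapp.
rewrite mulr_sumr -big_split; apply: eq_bigr => i _ /=.
have prodE z : \prod_(j < p) upd u k z j (i j) 0 =
    z (i (Ordinal kp)) 0 * \prod_(j < p | j != Ordinal kp) u j (i j) 0.
  rewrite (bigD1 (Ordinal kp)) //= /upd eqxx; congr (_ * _).
  by apply: eq_bigr => j /negPf; rewrite -val_eqE /= => ->.
by rewrite !prodE !mxE; ring.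
Qed.
End Multilinear.

(** * Evaluation of the tensor operations; symmetry *)

Section Evaluation.
Set Implicit Arguments. Unset Strict Implicit. Unset Printing Implicit Defensive.
Variables (R : fieldType) (n : nat).
Implicit Types (u w : nat -> 'cV[R]_n) (x y s v : 'cV[R]_n) (M N : 'M[R]_n).

Lemma tapp_basis p (T : tensor R n p) (i : {ffun 'I_p -> 'I_n}) :
  tapp T (basis_seq R i) = T i.
Proof.
rewrite /tapp (bigD1 i) //= [X in _ * X]big1 => [|k _]; last first.
  by rewrite basis_seqE mxE eqxx.
rewrite mulr1 big1 ?addr0 // => j /eqP ji.
have [k jk] : exists k, j k != i k.
  apply/existsP; rewrite -negb_forall; apply/negP=> /forallP ij.
  by apply: ji; apply/ffunP=> k; apply/eqP.
by rewrite (bigD1 k) //= basis_seqE mxE (negPf jk) mul0r mulr0.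
Qed.

(** Entries are themselves values, at basis vectors, so tensor identities can be checked by
    evaluation. *)
Lemma tensorP p (T T' : tensor R n p) :
  (forall u, tapp T u = tapp T' u) -> T = T'.
Proof. by move=> TT'; apply/ffunP=> i; rewrite -!tapp_basis. Qed.

Lemma tappD p (T T' : tensor R n p) u : tapp (T + T') u = tapp T u + tapp T' u.
Proof. by rewrite -big_split; apply: eq_bigr => i _; rewrite ffunE mulrDl. Qed.

Lemma tapp_scale p c (T : tensor R n p) u : tapp (tscale c T) u = c * tapp T u.
Proof. by rewrite mulr_sumr; apply: eq_bigr => i _; rewrite ffunE mulrA. Qed.

Lemma tapp0 p u : tapp (0 : tensor R n p) u = 0.
Proof. by rewrite /tapp big1 // => i _; rewrite ffunE mul0r. Qed.

Lemma tappN p (T : tensor R n p) u : tapp (- T) u = - tapp T u.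
Proof. by apply/eqP; rewrite -addr_eq0 -tappD addNr tapp0. Qed.

Lemma tappB p (T T' : tensor R n p) u : tapp (T - T') u = tapp T u - tapp T' u.
Proof. by rewrite tappD tappN. Qed.

Lemma tapp_sum p (I : Type) (r : seq I) (P : pred I) (F : I -> tensor R n p) u :
  tapp (\sum_(j <- r | P j) F j) u = \sum_(j <- r | P j) tapp (F j) u.
Proof. exact: (big_morph (fun T => tapp T u) (fun T T' => tappD T T' u) (tapp0 p u)). Qed.

Lemma eq_slot p (T : tensor R n p) u w k x :
  u k = x -> (forall j, j != k -> u j = w j) -> tapp T u = tapp T (upd w k x).
Proof.
by move=> ukx uw; apply: eq_tapp => j _; rewrite /upd; case: eqVneq => [->|/uw].
Qed.

Lemma tapp_slot0 p (T : tensor R n p) u k : (k < p)%N -> u k = 0 -> tapp T u = 0.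
Proof.
move=> kp uk; rewrite /tapp big1 // => i _.
by rewrite (bigD1 (Ordinal kp)) //= uk mxE mul0r mulr0.
Qed.

Lemma tapp_lin p (T : tensor R n p) u k a x y : (k < p)%N ->
  tapp T (upd u k (a *: x + y)) = a * tapp T (upd u k x) + tapp T (upd u k y).
Proof. by move=> kp; have [_ ->] := multilinear_tapp T. Qed.

Lemma tapp_contrN p (T : tensor R n p) s q u : (q <= p)%N ->
  tapp (tcontrN T s q) u = tapp T (fun k => if (k < q)%N then s else u (k - q)%N).
Proof.
move=> qp; apply: tapp_tensor_of; split=> [w w' ww'|w k kp a x y].
  apply: eq_tapp => k kp; case: ltnP => // qk; apply: ww'.
  by rewrite ltn_sub2r // (leq_ltn_trans qk).
(* Slot [k] of the contraction is slot [k + q] of [T], behind the block of copies of [s]. *)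
have E z : tapp T (fun j => if (j < q)%N then s else upd w k z (j - q)%N) =
   tapp T (upd (fun j => if (j < q)%N then s else w (j - q)%N) (k + q)%N z).
  apply: eq_tapp => j jp; rewrite /upd; case: ltnP => qj.
    by rewrite (_ : j == _ = false) //; apply/eqP=> jE; rewrite jE ltnNge leq_addl in qj.
  by rewrite -(eqn_add2r q) subnK.
by rewrite !E tapp_lin // -ltn_subRL; move: kp; rewrite !ltn_subRL addnC.
Qed.

Lemma tapp_contr p (T : tensor R n p) s u : (0 < p)%N ->
  tapp (tcontr T s) u = tapp T (fun k => if k is k'.+1 then u k' else s).
Proof.
move=> p0; rewrite tapp_contrN //; apply: eq_tapp => -[|k] _ //=.
by rewrite subn1.
Qed.

Lemma tapp_outer p1 p2 (A : tensor R n p1) (B : tensor R n p2) u :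
  tapp (touter A B) u = tapp A u * tapp B (fun k => u (k + p1)%N).
Proof.
apply: (tapp_tensor_of (F := fun u => tapp A u * tapp B (fun k => u (k + p1)%N))).
split=> [w w' ww'|w k kp a x y].
  congr (_ * _); apply: eq_tapp => k kp; apply: ww'; first exact: ltn_addr.
  by rewrite addnC ltn_add2l.
case: (ltnP k p1) => kp1.
  have E z : tapp B (fun j => upd w k z (j + p1)%N) = tapp B (fun j => w (j + p1)%N).
    apply: eq_tapp => j _; rewrite /upd gtn_eqF //.
    by rewrite (leq_trans kp1) // leq_addl.
  by rewrite !E tapp_lin //; ring.
have EA z : tapp A (upd w k z) = tapp A w.
  by apply: eq_tapp => j jp; rewrite /upd ltn_eqF // (leq_trans jp).
have EB z : tapp B (fun j => upd w k z (j + p1)%N) =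
            tapp B (upd (fun j => w (j + p1)%N) (k - p1)%N z).
  by apply: eq_tapp => j jp; rewrite /upd -(eqn_add2r p1 j) subnK.
by rewrite !EA !EB tapp_lin ?ltn_subLR //; ring.
Qed.

Lemma tapp_resize p m (T : tensor R n p) u : p = m ->
  tapp (tresize m T) u = tapp T u.
Proof. by move=> <-; apply: tapp_tensor_of; apply: multilinear_tapp. Qed.

Definition dot v x : R := (v^T *m x) 0 0.

Lemma dot_lin v a x y : dot v (a *: x + y) = a * dot v x + dot v y.
Proof. by rewrite /dot mulmxDr -scalemxAr !mxE. Qed.

Lemma tapp_vtensor v u : tapp (vtensor v) u = dot v (u 0%N).
Proof.
apply: (tapp_tensor_of (F := fun u => dot v (u 0%N))).
split=> [w w' ->|w [|k] // _ a x y] //; exact: dot_lin.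
Qed.

Lemma tapp_powv j v u : tapp (tpowv j v) u = \prod_(k < j) dot v (u k).
Proof.
apply: (tapp_tensor_of (F := fun u => \prod_(k < j) dot v (u k))).
split=> [w w' ww'|w k kj a x y]; first by apply: eq_bigr => k _; rewrite ww'.
have E z : \prod_(l < j) dot v (upd w k z l) =
    dot v z * \prod_(l < j | l != Ordinal kj) dot v (w l).
  rewrite (bigD1 (Ordinal kj)) //= /upd eqxx; congr (_ * _).
  by apply: eq_bigr => l /negPf; rewrite -val_eqE /= => ->.
by rewrite !E dot_lin; ring.
Qed.

Lemma tapp_mat p (T : tensor R n p) M u : tapp (tmat T M) u = tapp T (fun k => M *m u k).
Proof.
apply: (tapp_tensor_of (F := fun u => tapp T (fun k => M *m u k))).
split=> [w w' ww'|w k kp a x y]; first by apply: eq_tapp => k kp; rewrite ww'.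
have E z : tapp T (fun j => M *m upd w k z j) =
           tapp T (upd (fun j => M *m w j) k (M *m z)).
  by apply: eq_tapp => j _; rewrite /upd; case: eqP.
by rewrite !E mulmxDr -scalemxAr tapp_lin.
Qed.

Lemma tmat_mul p (T : tensor R n p) M N : tmat (tmat T M) N = tmat T (M *m N).
Proof.
by apply: tensorP => u; rewrite !tapp_mat; apply: eq_tapp => k _; rewrite mulmxA.
Qed.

Lemma tmat1 p (T : tensor R n p) : tmat T 1%:M = T.
Proof.
by apply: tensorP => u; rewrite tapp_mat; apply: eq_tapp => k _; rewrite mul1mx.
Qed.

Lemma tmatB p (T T' : tensor R n p) M : tmat (T - T') M = tmat T M - tmat T' M.
Proof. by apply: tensorP => u; rewrite !(tapp_mat, tappB). Qed.

Lemma tmatD p (T T' : tensor R n p) M : tmat (T + T') M = tmat T M + tmat T' M.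
Proof. by apply: tensorP => u; rewrite !(tapp_mat, tappD). Qed.

Lemma tmat_inj p M : M \in unitmx -> injective (fun T : tensor R n p => tmat T M).
Proof.
move=> Mu T T' /(congr1 (fun T => tmat T (invmx M))).
by rewrite !tmat_mul mulmxV // !tmat1.
Qed.

Lemma tcontrB p (T T' : tensor R n p) s : (0 < p)%N ->
  tcontr (T - T') s = tcontr T s - tcontr T' s.
Proof. by move=> p0; apply: tensorP => u; rewrite !(tapp_contr, tappB). Qed.

(** The permuted argument list inside [tperm]. The default 0 sits at positions from [p] on, which a
    tensor of order [p] never reads. *)
Definition act_seq p (sg : 'S_p) u : nat -> 'cV[R]_n :=
  fun k => if insub k is Some j then u (val (sg j)) else 0.

Lemma act_seqE p (sg : 'S_p) u (k : 'I_p) : act_seq sg u k = u (sg k).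
Proof. by rewrite /act_seq valK. Qed.

Lemma act_seqP p (sg : 'S_p) u w :
  (forall k : 'I_p, w k = u (sg k)) -> forall k, (k < p)%N -> act_seq sg u k = w k.
Proof. by move=> wu k kp; rewrite (act_seqE sg u (Ordinal kp)) -wu. Qed.

Lemma tapp_perm p (sg : 'S_p) (T : tensor R n p) u :
  tapp (tperm sg T) u = tapp T (act_seq sg u).
Proof.
apply: (tapp_tensor_of (F := fun u => tapp T (act_seq sg u))).
split=> [w w' ww'|w k kp a x y].
  by apply: eq_tapp; apply: act_seqP => k; rewrite act_seqE ww'.
(* Argument [k] is read at the position that [sg] sends to [k], so updating it changes one slot
   only. *)
have E z : tapp T (act_seq sg (upd w k z)) =
   tapp T (upd (act_seq sg w) (sg^-1 (Ordinal kp))%g z).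
  apply: eq_tapp; apply: act_seqP => j; rewrite /upd act_seqE.
  rewrite val_eqE (_ : (val (sg j) == k) = (sg j == Ordinal kp)) //.
  by rewrite -(inj_eq (@perm_inj _ sg) j) permKV.
by rewrite !E tapp_lin.
Qed.

Lemma tsymP p (T : tensor R n p) :
  tsym T <-> forall (sg : 'S_p) u, tapp T (act_seq sg u) = tapp T u.
Proof.
split=> [symT sg u|symT sg]; first by rewrite -tapp_perm symT.
by apply: tensorP => u; rewrite tapp_perm.
Qed.

Lemma tsymB p (T T' : tensor R n p) : tsym T -> tsym T' -> tsym (T - T').
Proof.
by move=> /tsymP sT /tsymP sT'; apply/tsymP => sg u; rewrite !tappB sT sT'.
Qed.

Lemma tsym_sum p (I : Type) (r : seq I) (F : I -> tensor R n p) :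
  (forall j, tsym (F j)) -> tsym (\sum_(j <- r) F j).
Proof.
move=> sF; apply/tsymP=> sg u; rewrite !tapp_sum; apply: eq_bigr => j _.
by move/tsymP: (sF j) => ->.
Qed.

Lemma tsym_scale p c (T : tensor R n p) : tsym T -> tsym (tscale c T).
Proof. by move=> /tsymP sT; apply/tsymP => sg u; rewrite !tapp_scale sT. Qed.

Lemma tsym_mat p (T : tensor R n p) M : tsym T -> tsym (tmat T M).
Proof.
move=> /tsymP sT; apply/tsymP => sg u; rewrite !tapp_mat -[RHS](sT sg).
by apply: eq_tapp => k kp; apply/esym; move: k kp; apply: act_seqP => k; rewrite act_seqE.
Qed.

Lemma tapp_Psym p (T : tensor R n p) u :
  tapp (Psym T) u = (p`!%:R)^-1 * \sum_(sg : 'S_p) tapp T (act_seq sg u).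
Proof.
rewrite (eq_bigr (fun sg => tapp (tperm sg T) u)) => [|sg _]; last by rewrite tapp_perm.
rewrite -tapp_sum -tapp_scale; congr (tapp _ u).
by apply/ffunP=> i; rewrite !ffunE sum_ffunE.
Qed.

(** Acting by [sg] merely rearranges the terms of the average, by right translation in the group. *)
Lemma tsym_Psym p (T : tensor R n p) : tsym (Psym T).
Proof.
apply/tsymP=> sg u; rewrite !tapp_Psym; congr (_ * _).
rewrite [RHS](reindex_inj (mulIg sg)) /=; apply: eq_bigr => sg' _.
apply: eq_tapp; apply: act_seqP => k.
by rewrite !act_seqE permM.
Qed.
End Evaluation.

(** * Binomial expansion of a symmetric tensor *)

Section Binomial.
Set Implicit Arguments. Unset Strict Implicit. Unset Printing Implicit Defensive.
Variables (R : fieldType) (n p : nat) (T : tensor R n p).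
Implicit Types (x y : 'cV[R]_n) (l : seq 'cV[R]_n).

(** With arguments held in lists, symmetry becomes invariance under [perm_eq], so blocks can be
    moved without naming a permutation. *)
Lemma tapp_perm_eq l l' : tsym T -> size l' = p -> perm_eq l l' ->
  tapp T (nth 0 l) = tapp T (nth 0 l').
Proof.
move=> /tsymP symT sz ll'; have sz' : size l' == p by apply/eqP.
have /tuple_permP[sg lE] : perm_eq l (Tuple sz') by [].
rewrite -[RHS](symT sg); apply: eq_tapp => k kp; apply/esym.
move: k kp; apply: act_seqP => k.
by rewrite lE (nth_map k) ?size_enum_ord // nth_ord_enum (tnth_nth 0).
Qed.

Lemma tapp_lin_cat l l' a x y : (size l < p)%N ->
  tapp T (nth 0 (l ++ (x + a *: y) :: l')) =
  tapp T (nth 0 (l ++ x :: l')) + a * tapp T (nth 0 (l ++ y :: l')).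
Proof.
move=> lp; have E z : tapp T (nth 0 (l ++ z :: l')) =
    tapp T (upd (nth 0 (l ++ 0 :: l')) (size l) z).
  apply: eq_slot => [|j jl]; first by rewrite nth_cat ltnn subnn.
  rewrite !nth_cat; case: ltnP => // lj.
  by case: (j - size l)%N (subn_eq0 j (size l)) => // /esym; rewrite leq_eqVlt (negPf jl) ltnNge lj.
by rewrite !E addrC tapp_lin // addrC.
Qed.

(** Induction on [r]: the first copy of [x + t *: y] is split by linearity, the prefix [l] absorbs
    the resulting [x] or [y], and Pascal's rule merges the two sums. The free prefix also serves
    polarization. *)
Lemma tapp_binomial_cat x y t r l : tsym T -> (size l + r)%N = p ->
  tapp T (nth 0 (l ++ nseq r (x + t *: y))) =
  \sum_(j < r.+1) 'C(r, j)%:R * t ^+ j * tapp T (nth 0 (l ++ nseq j y ++ nseq (r - j) x)).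
Proof.
move=> symT; elim: r l => [|r IH] l szl.
  by rewrite big_ord1 /= bin0 !mul1r.
rewrite tapp_lin_cat -?szl ?addnS ?ltnS ?leq_addr // -!cat_rcons.
rewrite !IH ?size_rcons ?addSnnS //.
pose G j := tapp T (nth 0 (l ++ nseq j y ++ nseq (r.+1 - j) x)).
(* By symmetry the [x] at the end of the prefix may move behind the block of [y]. *)
have Gx j : (j < r.+1)%N ->
    tapp T (nth 0 (rcons l x ++ nseq j y ++ nseq (r - j) x)) = G j.
  move=> jr; apply: tapp_perm_eq => //.
    by rewrite !size_cat !size_nseq subnKC // ltnW.
  rewrite cat_rcons perm_cat2l subSn //= -cat1s.
  by rewrite perm_catCA.
have Gy j : tapp T (nth 0 (rcons l y ++ nseq j y ++ nseq (r - j) x)) = G j.+1.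
  by rewrite cat_rcons /G subSS.
under eq_bigr => j _ do rewrite Gx //.
under [X in t * X]eq_bigr => j _ do rewrite Gy.
rewrite -/(G _) [RHS]big_ord_recl /= -[tapp _ _]/(G 0%N).
(* The first sum gets the same range as the second: its term 0 is split off, and a top term with
   coefficient ['C(r, r.+1)], which is 0, is added. *)
rewrite [X in X + _](_ : _ = G 0%N + \sum_(j < r.+1) 'C(r, j.+1)%:R * t ^+ j.+1 * G j.+1); last first.
  by rewrite big_ord_recl [in RHS]big_ord_recr /= !bin0 bin_small // !mul0r addr0 !mul1r.
rewrite bin0 !mul1r -addrA; congr (_ + _); rewrite mulr_sumr -big_split /=.
apply: eq_bigr => j _; rewrite binS natrD -[bump 0 j]/(j.+1) exprS.
rewrite -[tapp _ _]/(G j.+1); ring.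
Qed.

Lemma tapp_binomial x y t : tsym T ->
  tapp T (fun=> x + t *: y) =
  \sum_(j < p.+1) 'C(p, j)%:R * t ^+ j * tapp T (fun k => if (k < j)%N then y else x).
Proof.
move=> symT; have -> : tapp T (fun=> x + t *: y) = tapp T (nth 0 ([::] ++ nseq p (x + t *: y))).
  by apply: eq_tapp => k kp; rewrite /= nth_nseq kp.
rewrite tapp_binomial_cat //; apply: eq_bigr => j _; congr (_ * _).
apply: eq_tapp => k kp; rewrite /= nth_cat !nth_nseq size_nseq.
by case: ltnP => // jk; rewrite ltn_sub2r // (leq_ltn_trans jk).
Qed.
End Binomial.

(** * Polarization *)

Section Polarization.
Set Implicit Arguments. Unset Strict Implicit. Unset Printing Implicit Defensive.
Variables (R : numFieldType) (n : nat).

(** In characteristic 0 there are enough nonzero points to force a polynomial to vanish. Excluding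
    [t = 0] suits forms known to vanish only off a hyperplane. *)
Lemma sum_exp_eq0 m (c : nat -> R) :
  (forall t, t != 0 -> \sum_(j < m) c j * t ^+ j = 0) ->
  forall j, (j < m)%N -> c j = 0.
Proof.
move=> c0 j jm; pose q : {poly R} := \poly_(j < m) c j.
suff q0 : q = 0 by have := coef_poly m c j; rewrite jm -/q q0 coef0.
apply/eqP/negPn/negP => qn0.
(* The points 1, ..., [size q]: distinct, nonzero, and more numerous than the degree of [q]. *)
pose rs : seq R := [seq i.+1%:R | i <- iota 0 (size q)].
have rs_root : all (root q) rs.
  apply/allP=> _ /mapP[i _ ->]; apply/eqP.
  by rewrite horner_poly c0 // pnatr_eq0.
have rs_uniq : uniq rs.
  rewrite map_inj_uniq ?iota_uniq // => i j' /eqP.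
  by rewrite eqr_nat => /eqP[].
by have := max_poly_roots qn0 rs_root rs_uniq; rewrite size_map size_iota ltnn.
Qed.

Lemma tsym_diag_eq0 p (T : tensor R n p) : tsym T ->
  (forall x, tapp T (fun=> x) = 0) -> T = 0.
Proof.
move=> symT T0.
(* Arguments are freed one at a time: [l] holds the arbitrary ones, followed by [r] equal ones. *)
have pol r l x : (size l + r)%N = p -> tapp T (nth 0 (l ++ nseq r x)) = 0.
  elim/last_ind: l r x => [|l y IH] r x szl.
    rewrite -[RHS](T0 x); apply: eq_tapp => k kp.
    by rewrite nth_nseq (_ : r = p) ?kp.
  rewrite size_rcons addSnnS in szl.
  pose c j := 'C(r.+1, j)%:R * tapp T (nth 0 (l ++ nseq j y ++ nseq (r.+1 - j) x)).
  (* The coefficient of [t] along [x + t *: y] is [r.+1] times the value with one further free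
     argument [y], and [r.+1] is nonzero in [R]. *)
  have : c 1%N = 0.
    apply: (@sum_exp_eq0 r.+2 c) => // t _.
    rewrite -[RHS](IH r.+1 (x + t *: y)) // tapp_binomial_cat //.
    by apply: eq_bigr => j _; rewrite /c mulrAC.
  move/eqP; rewrite /c mulf_eq0 bin1 pnatr_eq0 /= subn1 => /eqP.
  by rewrite cat_rcons.
apply: tensorP => u; rewrite tapp0 -(pol 0%N (mkseq u p) 0) ?addn0 ?size_mkseq //.
by apply: eq_tapp => k kp; rewrite cats0 nth_mkseq.
Qed.

Lemma tsym_diag_inj p (T T' : tensor R n p) : tsym T -> tsym T' ->
  (forall x, tapp T (fun=> x) = tapp T' (fun=> x)) -> T = T'.
Proof.
move=> sT sT' TT'; apply/eqP; rewrite -subr_eq0; apply/eqP/tsym_diag_eq0.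
  exact: tsymB.
by move=> x; rewrite tappB TT' subrr.
Qed.

(** Permuting equal arguments changes nothing, so all [p]! terms of the average agree and forms do
    not see [Psym]. *)
Lemma tapp_Psym_diag p (T : tensor R n p) x : tapp (Psym T) (fun=> x) = tapp T (fun=> x).
Proof.
rewrite tapp_Psym (eq_bigr (fun=> tapp T (fun=> x))) => [|sg _]; last first.
  by apply: eq_tapp; apply: act_seqP.
rewrite sumr_const card_Sn -[X in _ * X]mulr_natl mulKf //.
by rewrite pnatr_eq0 -lt0n fact_gt0.
Qed.
End Polarization.

(** * The projector along [s], and the expressions in (b) and (c) *)

Section Update.
Set Implicit Arguments. Unset Strict Implicit. Unset Printing Implicit Defensive.
Variables (R : numFieldType) (n : nat) (v s : 'cV[R]_n).
Hypothesis vs0 : dot v s != 0.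
Implicit Type x : 'cV[R]_n.

(** The projector onto the orthogonal complement of [v], along [s]. *)
Definition proj : 'M[R]_n := 1%:M - (dot v s)^-1 *: (s *m v^T).

Lemma proj_mul x : proj *m x = x + (- (dot v s)^-1 * dot v x) *: s.
Proof.
rewrite mulmxBl mul1mx -scalemxAl -mulmxA [v^T *m x]mx11_scalar mul_mx_scalar.
by rewrite scalerA mulNr scaleNr.
Qed.

Lemma proj_ker : proj *m s = 0.
Proof. by rewrite proj_mul mulNr mulVf // scaleN1r subrr. Qed.

Lemma dot_proj x : dot v (proj *m x) = 0.
Proof. by rewrite proj_mul addrC dot_lin !mulNr mulrAC mulVf // mul1r addNr. Qed.

Lemma tcontr_mat_proj p (T : tensor R n p) : (0 < p)%N ->
  tcontr (tmat T proj) s = 0.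
Proof.
move=> p0; apply: tensorP => u; rewrite tapp_contr // tapp_mat tapp0.
by apply: (@tapp_slot0 _ _ _ _ _ 0%N); rewrite ?proj_ker.
Qed.

(** In the binomial expansion of the form of [H] at [proj *m x], every term but the first has an
    argument [s] and vanishes. *)
Lemma tcontr0_proj p (H : tensor R n p) : (0 < p)%N -> tsym H ->
  tcontr H s = 0 -> tmat H proj = H.
Proof.
move=> p0 symH Hs0; apply: tsym_diag_inj => // [|x]; first exact: tsym_mat.
rewrite tapp_mat (eq_tapp _ (w := fun=> x + (- (dot v s)^-1 * dot v x) *: s)); last first.
  by move=> k _; rewrite proj_mul.
rewrite tapp_binomial // big_ord_recl bin0 !mul1r /= big1 ?addr0 // => j _.
have -> : tapp H (fun k => if (k < bump 0 j)%N then s else x) =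
    tapp (tcontr H s) (fun k => if (k < j)%N then s else x).
  by rewrite tapp_contr //; apply: eq_tapp => -[].
by rewrite Hs0 tapp0 mulr0.
Qed.

(** The power [i] of [v] is kept apart from the number [j] of contractions: [i = j] gives the terms
    of (b), [i = j - 1] those of the tensor in (c). *)
Lemma outer_powv_contr_diag p m i j (D : tensor R n p) x :
  (j <= p)%N -> (i + (p - j))%N = m ->
  tapp (Psym (tresize m (touter (tpowv i v) (tcontrN D s j)))) (fun=> x) =
  dot v x ^+ i * tapp D (fun k => if (k < j)%N then s else x).
Proof.
move=> jp ijm; rewrite tapp_Psym_diag tapp_resize // tapp_outer tapp_powv.
by rewrite prodr_const card_ord tapp_contrN.
Qed.

Lemma outer_vtensor_diag p (A : tensor R n (p - 1)) x : (0 < p)%N ->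
  tapp (Psym (tresize p (touter A (vtensor v)))) (fun=> x) =
  tapp A (fun=> x) * dot v x.
Proof.
by move=> p0; rewrite tapp_Psym_diag tapp_resize ?subnK // tapp_outer tapp_vtensor.
Qed.

Lemma sub_mat_proj_diag p (D : tensor R n p) x : tsym D ->
  tapp (D - tmat D proj) (fun=> x) =
  \sum_(1 <= j < p.+1) (-1) ^+ j.+1 * 'C(p, j)%:R * dot v s ^- j * dot v x ^+ j *
     tapp D (fun k => if (k < j)%N then s else x).
Proof.
move=> symD; rewrite tappB tapp_mat.
rewrite [X in _ - X](eq_tapp _ (w := fun=> x + (- (dot v s)^-1 * dot v x) *: s)); last first.
  by move=> k _; rewrite proj_mul.
(* The term of index 0 is the form of [D] itself and cancels; the outer minus sign turns the power
   [j] of -1 into [j.+1]. *)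
rewrite tapp_binomial // big_ord_recl bin0 !mul1r /= opprD addNKr.
rewrite big_add1 big_mkord -sumrN; apply: eq_bigr => j _.
rewrite -[bump 0 j]/(j.+1) exprMn [(-1) ^+ j.+2]exprS (exprNn (dot v s)^-1) exprVn.
ring.
Qed.

Lemma sub_mat_proj p (D : tensor R n p) : tsym D ->
  D - tmat D proj = \sum_(1 <= j < p.+1)
    tscale ((-1) ^+ j.+1 * (binomial p j)%:R * dot v s ^- j)
      (Psym (tresize p (touter (tpowv j v) (tcontrN D s j)))).
Proof.
move=> symD; apply: tsym_diag_inj => [||x].
- exact/tsymB/tsym_mat.
- by apply: tsym_sum => j; apply/tsym_scale/tsym_Psym.
rewrite sub_mat_proj_diag // tapp_sum !big_nat; apply: eq_bigr => j /andP[_ jp].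
by rewrite tapp_scale outer_powv_contr_diag ?subnKC // !mulrA.
Qed.

Lemma sub_mat_proj_factor p (D : tensor R n p) : (0 < p)%N -> tsym D ->
  exists2 A : tensor R n (p - 1), tsym A &
    D - tmat D proj = Psym (tresize p (touter A (vtensor v))).
Proof.
move=> p0 symD; exists (\sum_(1 <= j < p.+1)
    tscale ((-1) ^+ j.+1 * (binomial p j)%:R * dot v s ^- j)
      (Psym (tresize (p - 1) (touter (tpowv (j - 1) v) (tcontrN D s j))))).
  by apply: tsym_sum => j; apply/tsym_scale/tsym_Psym.
apply: tsym_diag_inj => [||x].
- exact/tsymB/tsym_mat.
- exact: tsym_Psym.
rewrite sub_mat_proj_diag // outer_vtensor_diag // tapp_sum mulr_suml !big_nat.
(* The sum starts at 1, so [j - 1] is a genuine predecessor. *)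
apply: eq_bigr => -[//|j] /andP[_ jp].
rewrite tapp_scale outer_powv_contr_diag ?subn1 ?subSS ?subn0 //=; last first.
  by apply: succn_inj; rewrite -addSn subnKC // prednK.
rewrite [dot v x ^+ j.+1]exprS; ring.
Qed.

(* The form of E = Psym (A (x) v) is A(x) (v.x). If E[s] = 0 then E = E[proj],
   and v.x = 0 on the range of proj, so A(x) (v.x) = 0. Where v.x = 0, A(x) is
   the constant coefficient of the polynomial A(x + t s), which vanishes for t <> 0. *)
Lemma outer_vtensor_contr_eq0 p (A : tensor R n (p - 1)) : (0 < p)%N -> tsym A ->
  tcontr (Psym (tresize p (touter A (vtensor v)))) s = 0 -> A = 0.
Proof.
move=> p0 symA As0; set E := Psym _ in As0.
have E0 x : tapp A (fun=> x) * dot v x = 0.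
  rewrite -outer_vtensor_diag // -(tcontr0_proj p0 (tsym_Psym _) As0) tapp_mat.
  by rewrite outer_vtensor_diag // dot_proj mulr0.
have A0 x : dot v x != 0 -> tapp A (fun=> x) = 0.
  by move=> vx; apply/eqP; have /eqP := E0 x; rewrite mulf_eq0 (negPf vx) orbF.
apply: tsym_diag_eq0 => // x; have [vx|] := eqVneq (dot v x) 0; last exact: A0.
pose c j := 'C(p - 1, j)%:R * tapp A (fun k => if (k < j)%N then s else x).
have : c 0%N = 0.
  apply: (@sum_exp_eq0 _ (p - 1).+1) => // t t0.
  rewrite -[RHS](A0 (x + t *: s)) ?tapp_binomial //; last first.
    by rewrite addrC dot_lin vx addr0 mulf_neq0.
  by apply: eq_bigr => j _; rewrite /c mulrAC.
by rewrite /c bin0 mul1r.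
Qed.

Lemma outer_vtensor_contr_inj p (A A' : tensor R n (p - 1)) : (0 < p)%N ->
  tsym A -> tsym A' ->
  tcontr (Psym (tresize p (touter A (vtensor v)))) s =
  tcontr (Psym (tresize p (touter A' (vtensor v)))) s -> A = A'.
Proof.
move=> p0 sA sA' AA'; apply/eqP; rewrite -subr_eq0; apply/eqP.
apply: outer_vtensor_contr_eq0 => //; first exact: tsymB.
(* Linearity in [A] of the symmetrized product with [v], checked on forms. *)
rewrite (_ : Psym _ = Psym (tresize p (touter A (vtensor v))) -
                      Psym (tresize p (touter A' (vtensor v)))).
  by rewrite tcontrB // AA' subrr.
apply: tsym_diag_inj => [||x]; first exact: tsym_Psym.
  by apply: tsymB; apply: tsym_Psym.
by rewrite tappB !outer_vtensor_diag // tappB mulrBl.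
Qed.
End Update.

(** * The Frobenius inner product and norm *)

Section Frobenius.
Set Implicit Arguments. Unset Strict Implicit. Unset Printing Implicit Defensive.

Definition tinner (R : fieldType) n p (X Y : tensor R n p) : R := \sum_i X i * Y i.

Lemma tmatE (R : fieldType) n p (T : tensor R n p) M i :
  tmat T M i = \sum_(j : {ffun 'I_p -> 'I_n}) T j * \prod_(k < p) M (j k) (i k).
Proof.
rewrite -tapp_basis tapp_mat; apply: eq_bigr => j _; congr (_ * _).
apply: eq_bigr => k _; rewrite basis_seqE mxE (bigD1 (i k)) //= big1 ?addr0.
  by rewrite mxE eqxx mulr1.
by move=> l li; rewrite mxE (negPf li) mulr0.
Qed.

(** Both sides are one double sum over entries of [X] and [Y], weighted by products of entries of
    [M], summed in the two orders. *)
Lemma tinner_matl (R : fieldType) n p (X Y : tensor R n p) M :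
  tinner (tmat X M) Y = tinner X (tmat Y M^T).
Proof.
rewrite /tinner; under eq_bigr => i _ do rewrite tmatE mulr_suml.
rewrite exchange_big; apply: eq_bigr => j _ /=.
rewrite tmatE mulr_sumr; apply: eq_bigr => i _.
rewrite mulrAC -mulrA; congr (_ * (_ * _)).
by apply: eq_bigr => k _; rewrite mxE.
Qed.

Lemma tinnerBl (R : fieldType) n p (X X' Y : tensor R n p) :
  tinner (X - X') Y = tinner X Y - tinner X' Y.
Proof.
by rewrite -sumrB; apply: eq_bigr => i _; rewrite !ffunE mulrBl.
Qed.

Lemma sum_sqr_tensorD (R : fieldType) n p (X Y : tensor R n p) : tinner X Y = 0 ->
  \sum_i (X + Y) i ^+ 2 = \sum_i X i ^+ 2 + \sum_i Y i ^+ 2.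
Proof.
move=> XY0; transitivity (\sum_i X i ^+ 2 + \sum_i Y i ^+ 2 + tinner X Y * 2).
  rewrite mulr_suml -!big_split.
  by apply: eq_bigr => i _; rewrite ffunE /=; ring.
by rewrite XY0 mul0r addr0.
Qed.

Lemma fnorm_le (R : rcfType) n p (X Y : tensor R n p) :
  (fnorm X <= fnorm Y) = (\sum_i X i ^+ 2 <= \sum_i Y i ^+ 2).
Proof. by rewrite ler_sqrt // sumr_ge0 // => i _; rewrite sqr_ge0. Qed.

Lemma sum_sqr_tensor_le0 (R : rcfType) n p (X : tensor R n p) :
  \sum_i X i ^+ 2 <= 0 -> X = 0.
Proof.
move=> X0; have /psumr_eq0P X00 : forall i, true -> 0 <= X i ^+ 2.
  by move=> i _; rewrite sqr_ge0.
apply/ffunP=> i; rewrite ffunE; apply/eqP; rewrite -sqrf_eq0 X00 //.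
by apply/eqP; rewrite eq_le X0 sumr_ge0 // => j _; rewrite sqr_ge0.
Qed.

Lemma dot_self_neq0 (R : rcfType) n (x : 'cV[R]_n) : x != 0 -> dot x x != 0.
Proof.
apply: contraNneq => xx0; apply/eqP/colP=> i; rewrite mxE; apply/eqP.
rewrite -sqrf_eq0; have /psumr_eq0P -> // : forall i, true -> 0 <= x i 0 ^+ 2.
  by move=> j _; rewrite sqr_ge0.
by rewrite -[RHS]xx0 /dot mxE; apply: eq_bigr => j _; rewrite mxE expr2.
Qed.
End Frobenius.

(** * Agreement of the four descriptions *)

Theorem mainTheorem1 (R : rcfType) (n p : nat) (Cb Ct : tensor R n p)
    (W : 'M[R]_n) (s : 'cV[R]_n) :
  (2 <= p)%N -> (1 <= n)%N -> tsym Cb -> tsym Ct -> W \in unitmx -> s != 0 ->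
  let v := (invmx W)^T *m invmx W *m s in
  let vs := (v^T *m s) 0 0 in
  let M := 1%:M - ((s^T *m (invmx W)^T *m invmx W *m s) 0 0)^-1
                    *: (invmx W *m s *m s^T *m (invmx W)^T) in
  exists Cp : tensor R n p,
    [/\ tsym Cp,
     (* (a) *)
     (forall C : tensor R n p, tsym C ->
        ((tcontr C s = tcontr Ct s /\
          forall C' : tensor R n p, tsym C' -> tcontr C' s = tcontr Ct s ->
            fnorm (tmat (C - Cb) W) <= fnorm (tmat (C' - Cb) W))
         <-> C = Cp)),
     (* (b) *)
     Cp = Cb + \sum_(1 <= j < p.+1)
            tscale ((-1) ^+ j.+1 * (binomial p j)%:R * vs ^- j)
              (Psym (tresize p (touter (tpowv j v) (tcontrN (Ct - Cb) s j)))),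
     (* (c) *)
     (exists A : tensor R n (p - 1),
        [/\ tsym A,
            tcontr (Psym (tresize p (touter A (vtensor v)))) s = tcontr (Ct - Cb) s,
            (forall A' : tensor R n (p - 1), tsym A' ->
               tcontr (Psym (tresize p (touter A' (vtensor v)))) s = tcontr (Ct - Cb) s ->
               A' = A)
          & Cp = Cb + Psym (tresize p (touter A (vtensor v)))])
     & (* (d) *)
     forall C : tensor R n p,
       tmat (C - Ct) W = tmat (tmat (Cb - Ct) W) M <-> C = Cp].
Proof.
move=> p2 _ symCb symCt Wu s0 v vs M.
have p0 : (0 < p)%N by apply: leq_trans p2.
set N := invmx W in v vs M *.
have vT : v^T = s^T *m N^T *m N by rewrite /v !trmx_mul trmxK mulmxA.
(* The denominator is the squared length of [N *m s], nonzero because [N] is invertible. *)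
have vsE : vs = dot (N *m s) (N *m s).
  by rewrite /vs /dot vT trmx_mul !mulmxA.
have vs0 : dot v s != 0.
  rewrite -[dot v s]/vs vsE; apply: dot_self_neq0; apply: contraNneq s0 => Ns0.
  by rewrite -(mulKVmx Wu s) -/N Ns0 mulmx0.
pose Q := proj v s.
have ME : M = 1%:M - vs^-1 *: (N *m s *m s^T *m N^T) by rewrite /M -vT.
(* Both sides equal [W - vs^-1 *: (s *m s^T *m N^T)]; this exchanges [M] for the projector [Q]. *)
have WM : W *m M = Q *m W.
  rewrite ME /Q /proj mulmxBr mulmx1 mulmxBl mul1mx -scalemxAr -scalemxAl.
  by rewrite vT -/(dot v s) -!mulmxA mulVmx // mulmx1 !mulmxA mulmxV // mul1mx.
have MT : M^T = M.
  by rewrite ME linearB linearZ /= trmx1 !trmx_mul !trmxK !mulmxA.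
pose D := Ct - Cb; have symD : tsym D by apply: tsymB.
pose Cp := Ct - tmat D Q.
have CpE : Cp = Cb + (D - tmat D Q) by rewrite addrA [Cb + _]addrC subrK.
have Es : tcontr (D - tmat D Q) s = tcontr D s.
  by rewrite tcontrB // tcontr_mat_proj // subr0.
have symCp : tsym Cp by apply/tsymB/tsym_mat.
have Cps : tcontr Cp s = tcontr Ct s.
  by rewrite tcontrB // tcontr_mat_proj // subr0.
have pythagoras C : tsym C -> tcontr C s = tcontr Ct s ->
    \sum_i tmat (C - Cb) W i ^+ 2 =
    \sum_i tmat (Cp - Cb) W i ^+ 2 + \sum_i tmat (C - Cp) W i ^+ 2.
  move=> symC Cs; have -> : C - Cb = (Cp - Cb) + (C - Cp) by rewrite [RHS]addrC subrKA.
  rewrite (tmatD (Cp - Cb)); apply: sum_sqr_tensorD.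
  (* [C - Cp] is symmetric and its contraction with [s] is 0, so [Q] fixes it. *)
  have HM : tmat (tmat (C - Cp) W) M = tmat (C - Cp) W.
    rewrite tmat_mul WM -tmat_mul tcontr0_proj //; first exact: tsymB.
    by rewrite tcontrB // Cs Cps subrr.
  have -> : Cp - Cb = D - tmat D Q by rewrite CpE addrC addKr.
  (* The factor [M] moves across the inner product by symmetry and is absorbed there by [HM], so the
     two terms cancel. *)
  rewrite tmatB tinnerBl tmat_mul -WM -[tmat D (W *m M)]tmat_mul.
  by rewrite (tinner_matl (tmat D W)) MT HM subrr.
exists Cp; split=> //.
- move=> C symC; split=> [[Cs Cmin]|->].
    (* Comparing with the competitor [Cp], Pythagoras leaves no room for the square norm of [(C -
       Cp)[W]^p]. *)
    have := Cmin Cp symCp Cps; rewrite fnorm_le pythagoras // gerDl.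
    move/sum_sqr_tensor_le0 => CW; apply/eqP; rewrite -subr_eq0; apply/eqP.
    apply: (tmat_inj Wu); rewrite CW; apply/esym/tensorP => u.
    by rewrite tapp_mat !tapp0.
  split=> // C' symC' C's; rewrite fnorm_le (pythagoras C') // lerDl.
  by apply: sumr_ge0 => i _; rewrite sqr_ge0.
- by rewrite CpE sub_mat_proj.
- have [A symA EA] := sub_mat_proj_factor v s p0 symD.
  exists A; split=> //; [by rewrite -EA| |by rewrite CpE EA].
  move=> A' symA' A's; apply: (outer_vtensor_contr_inj vs0 p0) => //.
  by rewrite A's -EA Es.
(* Once [W] is cancelled, the right side of (d) is [Cp - Ct], which determines [C]. *)
have Cp_sub : tmat (Cb - Ct) Q = Cp - Ct.
  by rewrite /Cp /D !tmatB opprB [RHS]addrC addKr.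
move=> C; rewrite tmat_mul WM -tmat_mul Cp_sub; split=> [/(tmat_inj Wu)|-> //].
exact: addIr.
Qed.
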